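(* Let $\gamma$ be a non-negative random variable and let $\Lambda(\rho) := \mathbb{E}\exp(-\rho\gamma^{-1})$ for $\rho\ge 0$. For $p\in(0,1)$ let $g(p)$ be defined as a solution $r$ of the equation $$p=\Lambda(e^{r}-1).$$ For each $n\ge 1$ let $(\gamma_{ij})_{1\le i,j\le n}$ be i.i.d. copies of $\gamma$, let $(h_{ij})_{1\le i,j\le n}$ be i.i.d. standard exponential random variables independent of the array $(\gamma_{ij})$, and set $$w_{ij}=\log(1+\gamma_{ij}h_{ij}),\qquad R_\pi=\sum_{i=1}^n w_{i\pi(i)}\ \ (\pi\in\mathcal{S}_n),\qquad \mathcal{M}_R=\max_{\pi\in\mathcal{S}_n}R_\pi .$$ If the function $p\mapsto g(p)$ is slowly varying at zero, then $$\mathbb{E}\,\mathcal{M}_R\sim n\,g(1/n),\qquad\text{as } n\to\infty .$$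
   Context: $\mathcal{S}_n$ is the group of permutations of $\{1,\dots,n\}$, and $\log$ is the natural logarithm. ''Standard exponential'' means exponential with mean $1$. The expectation $\mathbb{E}\,\mathcal{M}_R$ is taken over both arrays $(\gamma_{ij})$ and $(h_{ij})$. In the definition of $\Lambda$, $\exp(-\rho\gamma^{-1})$ is read as $0$ when $\gamma=0$ and $\rho>0$, and as $1$ when $\rho=0$. The solution $r$ of $p=\Lambda(e^r-1)$ is sought in $r\ge 0$ (so that $e^r-1\ge 0$). A function $g$ is slowly varying at zero if it is positive near zero and, for every $c>0$, $g(cp)/g(p)\to 1$ as $p\to 0^+$. The notation $a_n\sim b_n$ means $a_n/b_n\to 1$. *)

(* Defs.v *)
From HB Require Import structures.
From mathcomp Require Import all_boot all_order all_algebra all_fingroup.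
From mathcomp Require Import all_classical all_reals all_analysis.

Set Implicit Arguments.
Unset Strict Implicit.
Unset Printing Implicit Defensive.

Import Order.TTheory GRing.Theory Num.Theory.
Import numFieldNormedType.Exports.

Local Open Scope classical_set_scope.
Local Open Scope ring_scope.

(* [exp (- rho / x)], read at [x = 0] as the indicator of [rho = 0].
   The case split is needed: in MathComp [0^-1 = 0], so the bare formula
   would be [1] at [x = 0] for every [rho]. *)
Definition exp_ratio (R : realType) (rho x : R) : R :=
  if x == 0 then (rho == 0)%:R else expR (- (rho * x^-1)).

Definition Lambda d (T : measurableType d) (R : realType)
    (P : probability T R) (gam : T -> R) (rho : R) : \bar R :=
  ('E_P[fun t => exp_ratio rho (gam t)])%E.

Definition Lambda_solution d (T : measurableType d) (R : realType)
    (P : probability T R) (gam : T -> R) (p r : R) : Prop :=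
  0 <= r /\ p%:E = Lambda P gam (expR r - 1).

Definition slowly_varying_at_zero (R : realType) (g : R -> R) : Prop :=
  (\forall p \near 0^'+, 0 < g p) /\
  (forall c : R, 0 < c -> (g (c * p) / g p) @[p --> 0^'+] --> (1 : R)).

Definition mutually_independent d (T : measurableType d) (R : realType)
    (P : probability T R) (I : finType) (X : I -> T -> R) : Prop :=
  forall (J : {set I}) (B : I -> set R),
    (forall i, measurable (B i)) ->
    P (\bigcap_(i in [set` J]) (X i @^-1` B i)) =
    (\prod_(i in J) P (X i @^-1` B i))%E.

Definition generated_sigma_algebra (T I : Type) (R : realType)
    (X : I -> T -> R) : set (set T) :=
  <<s [set A | exists (i : I) (B : set R), measurable B /\ A = X i @^-1` B] >>.

Definition independent_families d (T : measurableType d) (R : realType)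
    (P : probability T R) (I J : Type) (X : I -> T -> R) (Y : J -> T -> R)
    : Prop :=
  forall A B : set T,
    generated_sigma_algebra X A -> generated_sigma_algebra Y B ->
    P (A `&` B) = (P A * P B)%E.

Definition iid_copies d (T : measurableType d) (R : realType)
    (P : probability T R) (I : finType) (X : I -> {RV P >-> R})
    (mu : set R -> \bar R) : Prop :=
  mutually_independent P (fun i => X i : T -> R) /\
  (forall i (A : set R), measurable A -> distribution P (X i) A = mu A).

Section Assignment.
Variables (T : Type) (R : realType) (n : nat).
Variables (gam h : 'I_n * 'I_n -> T -> R).

Definition weight (ij : 'I_n * 'I_n) (t : T) : R :=
  ln (1 + gam ij t * h ij t).

Definition assignment_value (s : 'S_n) (t : T) : R :=
  \sum_(i < n) weight (i, s i) t.

(* The value at the identity permutation serves as the default of the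
   iterated maximum, so this is exactly the maximum over all of ['S_n]. *)
Definition max_assignment (t : T) : R :=
  \big[Num.max/assignment_value 1%g t]_(s : 'S_n) assignment_value s t.
End Assignment.

(* Main.v *)
(* Each weight satisfies [P (g p <= w) = p].
   Upper bound: [M <= n a + \sum_ij (w_ij - a)^+] with [a = g (1/n)]. Slicing
   the excess at the levels [g (2^-k / n)], which grow at most like
   [(1 + e)^k a] by slow variation while their tails decay like [2^-k / n],
   gives [E (w - a)^+ <= 4 e a / n].
   Lower bound: keep the entries [>= g (c/n)]. A permutation using as many of
   them as possible leaves a square block of [k] rows and [k] columns without
   any such entry; by independence and a union bound over blocks, [k >= e n]
   has probability at most [4^n exp (- c e^2 n)], which vanishes for
   [c = 3 / e^2], and [g (c/n) ~ g (1/n)]. *)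
Require Import Defs.
From HB Require Import structures.
From mathcomp Require Import all_boot all_order all_algebra all_fingroup.
From mathcomp Require Import all_classical all_reals all_analysis.
From mathcomp Require Import measurable_realfun.
From mathcomp Require Import ring lra.
Import Order.TTheory GRing.Theory Num.Theory.
Import numFieldNormedType.Exports.
Local Open Scope classical_set_scope.
Local Open Scope ring_scope.

(** * Deterministic facts on logarithmic thresholds and on permutations *)

(** Where [1 + x <= 0], [ln] takes its default value [0 < a] while [x < expR a - 1], so both sides
    fail. The equivalence thus applies at every sample point, even where [gam] or [h] is
    negative. *)
Lemma le_ln1p (R : realType) (a x : R) : 0 < a ->
  (a <= ln (1 + x)) = (expR a - 1 <= x).
Proof.
move=> a0; have [x1|x1] := ltP 0 (1 + x).
  by rewrite -[LHS]ler_expR lnK ?posrE// lerBlDl.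
rewrite ln0// leNgt a0/=; apply/esym/negbTE; rewrite -ltNge.
have : 1 < expR a by rewrite expR_gt1.
by move=> h; rewrite ltrBrDl (le_lt_trans x1)// expR_gt0.
Qed.

(* Two edges [(i, s i)] and [(j, s j)] missing from [e] while [(i, s j)] is
   present can be swapped to improve [s]. *)
Lemma perm_maximal_edges (n : nat) (e : 'I_n -> 'I_n -> bool) :
  exists (s : 'S_n) (A : {set 'I_n}),
    (forall i, (i \in A) = ~~ e i (s i)) /\
    (forall i j, i \in A -> j \in s @: A -> ~~ e i j).
Proof.
pose f (s : 'S_n) := #|[set i | e i (s i)]%SET|.
case: (arg_maxnP (i0 := 1%g : {perm (ordinal n)}) (P := fun=> true) f) => // s _ smax.
exists s, [set i | ~~ e i (s i)]%SET; split => [i|]; first by rewrite inE.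
move=> i j; rewrite inE => ei /imsetP[k]; rewrite inE => ek ->{j}.
apply/negP => eik.
have := smax (tperm i k * s)%g isT; rewrite /geq/= leqNgt => /negP; apply.
apply: proper_card; apply/properP; split; last first.
  by exists i; rewrite !inE ?(negbTE ei)// permM tpermL.
apply/fintype.subsetP => l; rewrite !inE permM => el.
case: tpermP => [li|lk|//]; first by rewrite li.
by move: el; rewrite lk (negbTE ek).
Qed.

(** * Tail of the product of a non-negative and an exponential variable *)

Lemma exponential_prob_itvcy (R : realType) (b : R) : 0 <= b ->
  exponential_prob 1 `[b, +oo[ = (expR (- b))%:E.
Proof.
move=> b0; rewrite /exponential_prob.
have cexp : continuous (fun z : R => expR (- 1 * z)).
  move=> z; apply: continuous_comp; last exact: continuous_expR.
  by apply: continuousM => //; exact: cst_continuous.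
rewrite (@ge0_continuous_FTC2y _ _ (fun x => - expR (- 1 * x)) _ 0)//.
- by rewrite mulN1r add0e EFinN oppeK.
- by move=> x _; exact: exponential_pdf_ge0.
- apply: (@continuous_subspaceW R^o _ _ [set` `[0, +oo[%R]).
    by apply: subset_itvr; rewrite bnd_simp.
  exact: within_continuous_exponential_pdf.
- rewrite -oppr0; apply: cvgN.
  under eq_fun do rewrite mulN1r.
  exact: cvgr_expR.
- by apply: cvgN; apply/cvg_at_right_filter; exact: cexp.
- move=> x xb; apply: derive1_exponential_pdf.
  by move: xb; rewrite !in_itv/= !andbT; exact: le_lt_trans.
Qed.

Lemma measurable_exp_ratio (R : realType) (rho : R) :
  measurable_fun [set: R] (exp_ratio rho).
Proof.
apply: measurable_fun_if => //.
- exact: measurable_fun_eqr.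
- rewrite setTI (_ : _ @^-1` _ = [set x | x != 0]); last first.
    by apply/seteqP; split => x /=; [move=> ->|move/negbTE].
  apply: measurableT_comp => //; apply: measurableT_comp => //.
  apply: measurable_funM => //.
  apply: open_continuous_measurable_fun; first exact: open_neq.
  by move=> x; rewrite inE; exact: inv_continuous.
Qed.

Lemma measurable_mul_ge (R : realType) (rho : R) :
  measurable [set z : R * R | rho <= z.1 * z.2].
Proof.
rewrite -[X in measurable X]setTI.
by apply: measurable_fun_le => //; exact: measurable_funM.
Qed.

(** Fubini: for [x > 0] the section is the half-line from [rho / x], of mass [expR (- (rho / x))];
    for [x = 0] it is empty since [rho > 0], which is the convention of [exp_ratio]. *)
Lemma product_tail_Lambda (R : realType) d (T : measurableType d)
    (P : probability T R) (X : {RV P >-> R}) (nu : probability R R) (rho : R) :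
  {ae P, forall t, 0 <= X t} ->
  (forall b, 0 <= b -> nu `[b, +oo[%classic = (expR (- b))%:E) -> 0 < rho ->
  (distribution P X \x nu)%E [set z | rho <= z.1 * z.2] = Lambda P X rho.
Proof.
move=> X0 nuE rho0; rewrite /Lambda unlock /product_measure1.
have mS := measurable_fun_xsection nu (measurable_mul_ge _ rho).
rewrite ge0_integral_distribution//.
apply: ae_eq_integral => //.
- exact: measurableT_comp.
- apply/measurable_EFinP; apply: measurableT_comp => //.
  exact: measurable_exp_ratio.
apply: filterS X0 => t Xt _ /=.
have [X0|Xn0] := eqVneq (X t) 0.
  rewrite /exp_ratio X0 eqxx gt_eqF//= (_ : xsection _ _ = set0) ?measure0//.
  by apply/seteqP; split => y //=; rewrite /xsection/= inE/= mul0r leNgt rho0.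
have Xgt0 : 0 < X t by rewrite lt_neqAle eq_sym Xn0.
rewrite /exp_ratio (negbTE Xn0) -nuE ?divr_ge0 ?ltW//; congr (nu _).
apply/seteqP; split => y; rewrite /xsection/= inE/= in_itv/= andbT;
  by rewrite ler_pdivrMr// mulrC.
Qed.

(** * Joint law of the independent pairs *)

Lemma finite_bigcap_measurable d (T : measurableType d) (I : finType)
    (J : {set I}) (F : I -> set T) :
  (forall i, measurable (F i)) -> measurable (\bigcap_(i in [set` J]) F i).
Proof. by move=> mF; apply: fin_bigcap_measurable => // i _; exact: mF. Qed.

Lemma generated_sigma_algebra_bigcap (T : pointedType) (I : finType)
    (R : realType) (X : I -> T -> R) (J : {set I}) (B : I -> set R) :
  (forall i, measurable (B i)) ->
  generated_sigma_algebra X (\bigcap_(i in [set` J]) (X i @^-1` B i)).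
Proof.
move=> mB; rewrite /generated_sigma_algebra.
set G := (X in <<s X >>).
(* [T] is viewed here as a measurable space whose sigma-algebra is the one generated by [X]. *)
apply: (@finite_bigcap_measurable _ (g_sigma_algebraType G)) => i.
by apply: sub_sigma_algebra; exists i, (B i).
Qed.

Section independent_pairs.
Context (R : realType) d (T : measurableType d) (P : probability T R).
Context (I : finType) (X Y : I -> {RV P >-> R}) (mu nu : probability R R).
Hypothesis Xind : mutually_independent P (fun i => X i : T -> R).
Hypothesis Yind : mutually_independent P (fun i => Y i : T -> R).
Hypothesis XYind : independent_families P
  (fun i => X i : T -> R) (fun i => Y i : T -> R).
Hypothesis Xmu : forall i A, measurable A -> distribution P (X i) A = mu A.
Hypothesis Ynu : forall i A, measurable A -> distribution P (Y i) A = nu A.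

Let Z i t := (X i t, Y i t).

Let mZ i : measurable_fun [set: T] (Z i).
Proof. exact: measurable_fun_pair. Qed.

Let mZpre i S : measurable S -> measurable (Z i @^-1` S).
Proof. by move=> mS; rewrite -[X in measurable X]setTI; exact: mZ. Qed.

(** The event is the intersection of an [X]-event and a [Y]-event: independence of the two families
    separates them, mutual independence factors each, and the factors are regrouped index by
    index. *)
Let rectangles (J : {set I}) (A B : I -> set R) :
  (forall i, measurable (A i)) -> (forall i, measurable (B i)) ->
  P (\bigcap_(i in [set` J]) (Z i @^-1` (A i `*` B i))) =
  (\prod_(i in J) (mu \x nu) (A i `*` B i))%E.
Proof.
move=> mA mB.
have -> : \bigcap_(i in [set` J]) (Z i @^-1` (A i `*` B i)) =
    (\bigcap_(i in [set` J]) (X i @^-1` A i)) `&`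
    (\bigcap_(i in [set` J]) (Y i @^-1` B i)).
  by rewrite -bigcapI.
rewrite XYind; [|exact: generated_sigma_algebra_bigcap..].
rewrite Xind// Yind// -big_split/=; apply: eq_bigr => i _.
by rewrite product_measure1E//= -(Xmu i)// -(Ynu i).
Qed.

(* One coordinate at a time, the sets [C i] are allowed to be arbitrary rather
   than rectangles: both sides are finite measures in [C i]. *)
Lemma independent_pairs (J : {set I}) (C : I -> set (R * R)) :
  (forall i, measurable (C i)) ->
  P (\bigcap_(i in [set` J]) (Z i @^-1` C i)) =
  (\prod_(i in J) (mu \x nu) (C i))%E.
Proof.
(* Induction on the list [K] of coordinates where [C i] may be arbitrary; outside [K] it is a
   rectangle. *)
suff H (K : seq I) : forall (J : {set I}) (C : I -> set (R * R)),
    (forall i, measurable (C i)) ->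
    (forall i, i \notin K -> exists A B, [/\ measurable A, measurable B &
                                         C i = A `*` B]) ->
    P (\bigcap_(i in [set` J]) (Z i @^-1` C i)) =
    (\prod_(i in J) (mu \x nu) (C i))%E.
  by move=> mC; apply: (H (enum I)) => // i; rewrite mem_enum.
elim: K => [|k K IH] {}J {}C mC rC.
  have /choice[A /choice[B AB]] : forall i, exists A B : set R,
    [/\ measurable A, measurable B & C i = A `*` B] by move=> i; exact: rC.
  rewrite (eq_bigcapr (G := fun i => Z i @^-1` (A i `*` B i))); last first.
    by move=> i _; have [_ _ ->] := AB i.
  rewrite rectangles => [|i|i]; [|by case: (AB i)..].
  by apply: eq_bigr => i _; have [_ _ ->] := AB i.
(* [upd S] puts [S] at coordinate [k]. When [S] is a rectangle, [k] no longer counts as arbitrary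
   and the induction hypothesis applies. *)
pose upd S i := if i == k then S else C i.
have updk S : upd S k = S by rewrite /upd eqxx.
have updn S i : i != k -> upd S i = C i by rewrite /upd => /negbTE ->.
have IHupd A B (J' : {set I}) : measurable A -> measurable B ->
    P (\bigcap_(i in [set` J']) (Z i @^-1` upd (A `*` B) i)) =
    (\prod_(i in J') (mu \x nu) (upd (A `*` B) i))%E.
  move=> mA mB; apply: IH => i; rewrite /upd; case: eqVneq => [_|ik]//.
  - exact: measurableX.
  - by exists A, B.
  - by move=> iK; apply: rC; rewrite inE negb_or ik.
have [kJ|kJ] := boolP (k \in J); last first.
  have Jk i : i \in J -> i != k by apply: contraTneq => ->.
  rewrite (eq_bigcapr (G := fun i => Z i @^-1` upd (setT `*` setT) i)); last first.
    by move=> i /= /Jk ik; rewrite updn.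
  by rewrite IHupd//; apply: eq_bigr => i /Jk ik; rewrite updn.
pose E := \bigcap_(i in [set` J] `\ k) (Z i @^-1` C i).
have JD : [set` J] `\ k = [set` (J :\ k)%SET] :> set I.
  apply/seteqP; split => i /=; rewrite !inE/=.
    by move=> [iJ /eqP ik]; rewrite ik.
  by move=> /andP[/eqP ik iJ].
have mE : measurable E.
  by rewrite /E JD; apply: finite_bigcap_measurable => i; exact: mZpre.
have EE : P E = (\prod_(i in J :\ k) (mu \x nu) (C i))%E.
  have Jk i : i \in (J :\ k)%SET -> i != k by rewrite !inE => /andP[].
  rewrite /E JD (eq_bigcapr (G := fun i => Z i @^-1` upd (setT `*` setT) i)); last first.
    by move=> i /= /Jk ik; rewrite updn.
  by rewrite IHupd//; apply: eq_bigr => i /Jk ik; rewrite updn.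
have PE A B : measurable A -> measurable B ->
    P (Z k @^-1` (A `*` B) `&` E) = ((mu A * nu B) * P E)%E.
  move=> mA mB; have := IHupd _ _ J mA mB.
  rewrite (@bigcap_setD1 _ _ k _ [set` J] kJ) updk.
  rewrite (eq_bigcapr (G := fun i => Z i @^-1` C i)); last first.
    by move=> i [_ /eqP ik]; rewrite updn.
  rewrite -/E => ->; rewrite (big_setD1 k kJ)/= updk product_measure1E// EE.
  by congr (_ * _)%E; apply: eq_bigr => i; rewrite !inE => /andP[ik _]; rewrite updn.
rewrite (@bigcap_setD1 _ _ k _ [set` J] kJ) -/E (big_setD1 k kJ)/= -EE.
(* Restricting [P] to [E] and pushing forward by [Z k] gives a measure in [S]. Divided by [P E], it
   coincides with [mu \x nu] by uniqueness of the product measure; if [P E = 0], both sides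
   vanish. *)
have [m' m'E] : exists m' : {measure set (R * R) -> \bar R},
    forall S, m' S = P (Z k @^-1` S `&` E).
  by unshelve eexists (pushforward (mrestr P mE) (Z k)).
have PEfin : P E \is a fin_num by exact: fin_num_measure.
have [PE0|PE0] := eqVneq (P E) 0%E.
  rewrite PE0 mule0; apply/eqP; rewrite eq_le measure_ge0 andbT -PE0.
  by apply: le_measure; rewrite ?inE//; apply: measurableI => //; exact: mZpre.
have r0 : 0 <= (fine (P E))^-1 by rewrite invr_ge0 fine_ge0.
have rn0 : fine (P E) != 0 by rewrite -eqe fineK.
pose r := NngNum r0.
have mE' S : mscale r m' S =
    ((fine (P E))^-1%:E * P (Z k @^-1` S `&` E))%E.
  by rewrite -m'E.
have -> : (mu \x nu)%E (C k) = mscale r m' (C k).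
  apply: product_measure_unique => // A B mA mB.
  rewrite [LHS]mE' PE// -[in LHS](fineK PEfin).
  by rewrite muleCA -EFinM mulVf// mule1.
by rewrite [X in (X * _)%E]mE' -[in RHS](fineK PEfin) muleAC -EFinM mulVf// mul1e.
Qed.
End independent_pairs.

(** * Law and sign of the individual weights *)

Lemma measurable_weight (R : realType) d (T : measurableType d) n
    (gam h : 'I_n * 'I_n -> T -> R) ij :
  measurable_fun [set: T] (gam ij) -> measurable_fun [set: T] (h ij) ->
  measurable_fun [set: T] (weight gam h ij).
Proof.
move=> mg mh; apply: measurableT_comp; first exact: measurable_ln.
by apply: measurable_funD => //; exact: measurable_funM.
Qed.

Section weights.
Context (R : realType).
Context d0 (T0 : measurableType d0) (P0 : probability T0 R).
Context (gamma0 : {RV P0 >-> R}).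
Hypothesis gamma0_ge0 : {ae P0, forall t, 0 <= gamma0 t}.
Context d (T : measurableType d) (P : probability T R) (n : nat).
Context (gam h : 'I_n * 'I_n -> {RV P >-> R}).
Hypothesis gam_iid : iid_copies gam (distribution P0 gamma0).
Hypothesis h_iid : iid_copies h (exponential_prob (1 : R)).
Hypothesis gam_h_indep : independent_families P
  (fun ij => gam ij : T -> R) (fun ij => h ij : T -> R).

Let W := weight (fun ij => gam ij : T -> R) (fun ij => h ij : T -> R).

(** A weight is below [a] exactly when its pair [(gam, h)] avoids the region [S], whose product mass
    is [Lambda P0 gamma0 (expR a - 1) = p]; the pairs are independent. *)
Lemma weights_lt (a p : R) (J : {set 'I_n * 'I_n}) : 0 < a ->
  p%:E = Lambda P0 gamma0 (expR a - 1) ->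
  P (\bigcap_(ij in [set` J]) [set t | W ij t < a]) = ((1 - p) ^+ #|J|)%:E.
Proof.
move=> a0 pE.
(* An index [ij0] is required because the law of [h ij0] serves as the probability [nu]; the empty
   [J] is therefore settled first. *)
have [->|[ij0 _]] := set_0Vmem J.
  rewrite (_ : [set` finset.set0] = set0); last first.
    by apply/seteqP; split => x //=; rewrite inE.
  by rewrite bigcap_set0 probability_setT cards0 expr0.
pose nu : probability R R := distribution P (h ij0).
have nuE A : measurable A -> nu A = exponential_prob (1 : R) A.
  exact: h_iid.2.
have rho0 : 0 < expR a - 1 by rewrite subr_gt0 expR_gt1.
pose S := [set z : R * R | expR a - 1 <= z.1 * z.2].
have mS : measurable S by exact: measurable_mul_ge.
rewrite (eq_bigcapr (G := fun ij =>
    (fun t => (gam ij t, h ij t)) @^-1` (~` S))); last first.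
  move=> ij _; apply/seteqP; split=> t;
    by rewrite /W /weight /S /= ltNge le_ln1p// => /negP.
have PS : (distribution P0 gamma0 \x nu)%E (~` S) = (1 - p)%:E.
  rewrite (product_subprobability_setC
    (distribution P0 gamma0 : subprobability _ _,
     nu : subprobability _ _))//= product_tail_Lambda//.
    rewrite -pE -setXTT product_measure1E//.
    rewrite [X in (X * _ - _)%E](probability_setT (distribution P0 gamma0)).
    by rewrite [X in (_ * X - _)%E](probability_setT nu) mule1.
  by move=> b b0; rewrite nuE// exponential_prob_itvcy.
rewrite (@independent_pairs _ _ _ P _ gam h (distribution P0 gamma0) nu)//.
- by rewrite PS prodEFin prodr_const.
- by case: gam_iid.
- by case: h_iid.
- by case: gam_iid.
- by move=> i A mA; rewrite nuE//; exact: h_iid.2.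
- by move=> i; exact: measurableC.
Qed.

Lemma weight_tail (a p : R) ij : 0 < a ->
  p%:E = Lambda P0 gamma0 (expR a - 1) ->
  P [set t | a <= W ij t] = p%:E.
Proof.
move=> a0 pE; have := weights_lt a p [set ij]%SET a0 pE.
rewrite cards1 expr1 (_ : [set` [set ij]%SET] = [set ij]); last first.
  by apply/seteqP; split => x /=; rewrite inE => /eqP.
rewrite bigcap_set1 => PE.
have mW : measurable [set t | W ij t < a].
  rewrite (_ : mkset _ = ~` [set t | a <= W ij t]); last first.
    by apply/seteqP; split => t /=; rewrite ltNge => /negP.
  apply: measurableC; rewrite -[X in measurable X]setTI.
  by apply: measurable_fun_le => //; exact: measurable_weight.
rewrite (_ : mkset _ = ~` [set t | W ij t < a]); last first.
  by apply/seteqP; split => t /=; rewrite leNgt => /negP.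
by rewrite probability_setC// PE -EFinB opprB addrC subrK.
Qed.

(** Negativity is read off the laws on []-oo, 0[]: that of [gam ij] is the law of [gamma0], and the
    exponential density vanishes there. *)
Lemma weight_ge0 ij : {ae P, forall t, 0 <= W ij t}.
Proof.
have mneg (X : {RV P >-> R}) : measurable (~` [set t | 0 <= X t]).
  apply: measurableC; rewrite -[X in measurable X]setTI.
  exact: measurable_fun_le.
have negE U (X : U -> R) : ~` [set t | 0 <= X t] = X @^-1` `]-oo, 0[.
  by apply/seteqP; split => t /=; rewrite in_itv/= ltNge => /negP.
have gam0 : {ae P, forall t, 0 <= gam ij t}.
  apply/negligibleP; first exact: mneg.
  rewrite negE; apply: etrans (gam_iid.2 ij `]-oo, 0[%classic _) _ => //.
  rewrite /distribution /pushforward -negE.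
  apply: (measure_negligible _ gamma0_ge0).
  apply: measurableC; rewrite -[X in measurable X]setTI.
  exact: measurable_fun_le.
have h0 : {ae P, forall t, 0 <= h ij t}.
  apply/negligibleP; first exact: mneg.
  rewrite negE; apply: etrans (h_iid.2 ij `]-oo, 0[%classic _) _ => //.
  rewrite /exponential_prob integral0_eq// => x/=; rewrite in_itv/= => x0.
  by rewrite lt0_exponential_pdf.
apply: filterS2 gam0 h0 => t g0 h0.
by rewrite /W /weight ln_ge0// lerDl mulr_ge0.
Qed.

End weights.

(** * Lower bound on the expected maximum *)

Lemma measure_bigsetU_le (R : realType) d (T : measurableType d)
    (mu : {measure set T -> \bar R}) (I : finType) (Q : pred I)
    (F : I -> set T) : (forall i, measurable (F i)) ->
  (mu (\big[setU/set0]_(i | Q i) F i) <= \sum_(i | Q i) mu (F i))%E.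
Proof.
move=> mF; suff [] : measurable (\big[setU/set0]_(i | Q i) F i) /\
  (mu (\big[setU/set0]_(i | Q i) F i) <= \sum_(i | Q i) mu (F i))%E by [].
apply: (big_ind2 (fun A x => measurable A /\ (mu A <= x)%E)) => //.
- by rewrite measure0.
- move=> A x B y [mA Ax] [mB By]; split; first exact: measurableU.
  exact: le_trans (measureU2 mu mA mB) (leeD Ax By).
Qed.

Section max_assignment.
Context (R : realType) d (T : measurableType d) (P : probability T R) (n : nat).
Context (gam h : 'I_n * 'I_n -> T -> R).

Let W := weight gam h.
Let M := max_assignment gam h.

Lemma le_max_assignment s t : assignment_value gam h s t <= M t.
Proof. exact: (le_bigmax _ (fun s => assignment_value gam h s t)). Qed.

Lemma max_assignment_le t x :
  (forall s, assignment_value gam h s t <= x) -> M t <= x.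
Proof. by move=> H; apply: bigmax_le. Qed.

Hypothesis mW : forall ij, measurable_fun [set: T] (W ij).
Hypothesis W0 : forall ij, {ae P, forall t, 0 <= W ij t}.

Lemma measurable_max_assignment : measurable_fun [set: T] M.
Proof.
have mA s : measurable_fun [set: T] (assignment_value gam h s).
  by apply: measurable_sum => i; exact: mW.
rewrite /M /max_assignment.
elim: (index_enum _) => [|s r IH].
  by under eq_fun do rewrite big_nil; exact: mA.
by under eq_fun do rewrite big_cons; exact: measurable_maxr.
Qed.

Lemma weights_ge0_ae : {ae P, forall t, forall ij, 0 <= W ij t}.
Proof.
suff H (r : seq ('I_n * 'I_n)) :
    {ae P, forall t, forall ij, ij \in r -> 0 <= W ij t}.
  by apply: filterS (H (enum {: 'I_n * 'I_n})) => t H' ij; apply: H'; rewrite mem_enum.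
elim: r => [|ij r IH]; first by apply: aeW => t ij.
apply: filterS2 (W0 ij) IH => t h1 h2 kl; rewrite inE => /predU1P[->//|].
exact: h2.
Qed.

Lemma max_assignment_ge0_ae : {ae P, forall t, 0 <= M t}.
Proof.
apply: filterS weights_ge0_ae => t H.
by apply: le_trans (le_max_assignment 1%g t); apply: sumr_ge0 => i _; exact: H.
Qed.

(** [M] is non-negative only almost surely. Its positive part is so everywhere, which allows
    integrals of non-negative functions to be compared. *)
Lemma expectation_max_assignment :
  ('E_P[M] = \int[P]_t (Num.max (M t) 0)%:E)%E.
Proof.
rewrite unlock; apply: ae_eq_integral => //.
- by apply/measurable_EFinP; exact: measurable_max_assignment.
- apply/measurable_EFinP; apply: measurable_maxr => //.
  exact: measurable_max_assignment.
- apply: filterS max_assignment_ge0_ae => t Mt _ /=.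
  by rewrite max_l.
Qed.

(* A permutation with the largest number [n - k] of entries [>= a] leaves a
   [k x k] submatrix all of whose entries are [< a]. *)
Lemma max_assignment_or_small_block (a e : R) t :
  0 <= a -> (forall ij, 0 <= W ij t) ->
  a * (1 - e) * n%:R <= M t \/
  exists A B : {set 'I_n}, [/\ e * n%:R <= #|A|%:R, #|B| = #|A| &
    forall ij, ij \in finset.setX A B -> W ij t < a].
Proof.
move=> a0 Wt; have [s [A [AE AB]]] := perm_maximal_edges n (fun i j => a <= W (i, j) t).
have cardB : #|s @: A| = #|A| by rewrite card_imset//; exact: perm_inj.
have [eA|Ae] := leP (e * n%:R) #|A|%:R.
  right; exists A, (s @: A); split => // -[i j]; rewrite inE/= => /andP[iA jB].
  by rewrite ltNge; exact: AB.
left; apply: le_trans (le_max_assignment s t); rewrite /assignment_value.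
(* Entries on [A] are bounded below by [0], and the [n - #|A|] others by [a]. *)
rewrite (bigID (mem A))/= -[leLHS]add0r; apply: lerD.
  by apply: sumr_ge0 => i _; exact: Wt.
have : \sum_(i | i \notin A) a <= \sum_(i | i \notin A) W (i, s i) t.
  by apply: ler_sum => i; rewrite AE negbK.
apply: le_trans; rewrite sumr_const -[leRHS]mulr_natr -mulrA ler_wpM2l//.
have := cardC (mem A); rewrite card_ord => /(congr1 (fun k => k%:R : R)).
rewrite natrD => /eqP; rewrite eq_sym -subr_eq => /eqP => AC.
rewrite (_ : #|_| = #|predC (mem A)|)//.
move: AC; set k := #|predC (mem A)|; move=> AC.
have -> : k%:R = n%:R - #|A|%:R :> R by rewrite -AC opprB addrC subrK.
by rewrite mulrBl mul1r lerB// ltW.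
Qed.

Lemma expectation_max_assignment_ge (a p e : R) :
  0 <= a -> 0 <= p <= 1 -> 0 <= e <= 1 ->
  (forall J : {set 'I_n * 'I_n},
    P (\bigcap_(ij in [set` J]) [set t | W ij t < a]) = ((1 - p) ^+ #|J|)%:E) ->
  ((a * (1 - e) * n%:R *
    (1 - 4 ^+ n * expR (- (p * (e * n%:R) ^+ 2))))%:E <= 'E_P[M])%E.
Proof.
move=> a0 /andP[p0 p1] /andP[e0 e1] PJ.
pose F (AB : {set 'I_n} * {set 'I_n}) :=
  \bigcap_(ij in [set` finset.setX AB.1 AB.2]) [set t | W ij t < a].
have mF AB : measurable (F AB).
  apply: finite_bigcap_measurable => ij.
  rewrite (_ : mkset _ = ~` [set t | a <= W ij t]); last first.
    by apply/seteqP; split => t /=; rewrite ltNge => /negP.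
  apply: measurableC; rewrite -[X in measurable X]setTI.
  exact: measurable_fun_le.
pose Q (AB : {set 'I_n} * {set 'I_n}) :=
  (e * n%:R <= #|AB.1|%:R) && (#|AB.2| == #|AB.1|).
pose bad := \big[setU/set0]_(AB | Q AB) F AB.
have mbad : measurable bad by exact: bigsetU_measurable.
set q := 4 ^+ n * expR _.
have Pbad : (P bad <= q%:E)%E.
  apply: le_trans (measure_bigsetU_le _ _ _ P _ Q F mF) _.
  apply: (@le_trans _ _ (\sum_(AB | Q AB) (expR (- (p * (e * n%:R) ^+ 2)))%:E)%E).
    apply: lee_sum => -[A B]; rewrite /Q/= => /andP[eA /eqP BA].
    rewrite /F/= PJ lee_fin cardsX BA.
    (* From [1 - p <= expR (- p)]; then [#|A| * #|A| >= (e * n) ^ 2]. *)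
    apply: (@le_trans _ _ (expR (- p) ^+ (#|A| * #|A|))).
      by rewrite lerXn2r ?nnegrE ?subr_ge0 ?expR_ge0// expR_ge1Dx.
    rewrite -expRM_natl ler_expR. rewrite mulrN lerN2 mulrC ler_wpM2r//.
    by rewrite natrM expr2 ler_pM// mulr_ge0.
  rewrite sumEFin lee_fin sumr_const -[leLHS]mulr_natl ler_wpM2r ?expR_ge0//.
  (* There are [2 ^ n * 2 ^ n = 4 ^ n] pairs of subsets in all. *)
  rewrite -natrX ler_nat (leq_trans (max_card _))//.
  by rewrite card_prod -cardsT -powersetT card_powerset cardsT card_ord -expnMn.
have c0 : 0 <= a * (1 - e) * n%:R by rewrite !mulr_ge0// subr_ge0.
rewrite expectation_max_assignment.
(* Off [bad] the maximum is at least [a * (1 - e) * n]; on [bad] the positive part is bounded below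
   by [0]. *)
apply: (@le_trans _ _ (\int[P]_t ((a * (1 - e) * n%:R)%:E * (\1_(~` bad) t)%:E))%E).
  rewrite ge0_integralZl_EFin//; last first.
    by apply/measurable_EFinP; apply: measurable_indic; exact: measurableC.
  rewrite integral_indic ?setIT//; last exact: measurableC.
  rewrite [X in (_ <= _ * X)%E]probability_setC// EFinM lee_wpmul2l ?lee_fin//.
  by rewrite EFinB leeB.
apply: ae_ge0_le_integral => //.
- by move=> t _; rewrite -EFinM lee_fin mulr_ge0.
- under eq_fun do rewrite -EFinM; apply/measurable_EFinP.
  by apply: measurable_funM => //; apply: measurable_indic; exact: measurableC.
- by move=> t _; rewrite lee_fin le_max lexx orbT.
- apply/measurable_EFinP; apply: measurable_maxr => //.
  exact: measurable_max_assignment.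
apply: filterS weights_ge0_ae => t Wt _; rewrite -EFinM lee_fin le_max.
rewrite indicE; case: (boolP (t \in ~` bad)); last by rewrite mulr0 lexx orbT.
rewrite inE mulr1 => tbad.
have [->//|[A [B [eA BA AB]]]] := max_assignment_or_small_block a e t a0 Wt.
exfalso; apply: tbad; rewrite /bad.
rewrite (bigD1 (A, B))/=; last by rewrite /Q/= eA BA eqxx.
by left => ij /= ijAB; exact: AB.
Qed.

End max_assignment.

(** * Upper bound on the expected maximum *)

Section excess.
Context (R : realType) d (T : measurableType d) (P : probability T R).
Context (a : nat -> R) (e q : R).
Hypothesis e_ge0 : 0 <= e.
Hypothesis e_le : e <= 2^-1.
Hypothesis q_ge0 : 0 <= q.
Hypothesis a0_ge0 : 0 <= a 0.
Hypothesis a_incr : forall k, a k <= a k.+1.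
Hypothesis a_growth : forall k, a k.+1 <= (1 + e) * a k.

(** The increment is at most [e * a k <= e * (1 + e) ^+ k * a 0], and [(1 + e) / 2 <= 3 / 4] because
    [e <= 1 / 2]. Keeping the factor [e] is what makes the total excess small. *)
Lemma levels_increment k : (a k.+1 - a k) * (q / 2 ^+ k) <= e * a 0 * q * (3 / 4) ^+ k.
Proof.
have ak : a k <= (1 + e) ^+ k * a 0.
  elim: k => [|k IH]; first by rewrite mul1r.
  apply: le_trans (a_growth k) _; rewrite exprS -mulrA ler_wpM2l// addr_ge0//.
have inc : a k.+1 - a k <= e * ((1 + e) ^+ k * a 0).
  apply: (@le_trans _ _ (e * a k)); last by rewrite ler_wpM2l.
  by rewrite lerBlDr (le_trans (a_growth k))// mulrDl mul1r addrC.
have e32 : (1 + e) ^+ k <= (3 / 2) ^+ k.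
  rewrite lerXn2r ?nnegrE ?addr_ge0//.
  by apply: (@le_trans _ _ (1 + 2^-1)); [rewrite lerD2l | lra].
have -> : (3 / 4 : R) ^+ k = (3 / 2) ^+ k / 2 ^+ k.
  by rewrite -exprVn -exprMn; congr (_ ^+ k); field.
rewrite mulrA [leRHS]mulrA ler_wpM2r ?invr_ge0 ?exprn_ge0//.
rewrite [leRHS]mulrAC ler_wpM2r// (le_trans inc)//.
by rewrite -mulrA ler_wpM2l// mulrC ler_wpM2l.
Qed.

Context (X : T -> R).
Hypothesis mX : measurable_fun [set: T] X.
Hypothesis X_tail : forall k, (P [set t | (a k <= X t)%R] <= (q / 2 ^+ k)%:E)%E.

Let mtail k : measurable [set t | a k <= X t].
Proof.
by rewrite -[X in measurable X]setTI; exact: measurable_fun_le.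
Qed.

(** The tails [q / 2 ^+ k] tend to [0], so the event of exceeding every level is null. *)
Lemma below_some_level_ae : {ae P, forall t, exists k, X t < a k}.
Proof.
have mI : measurable (\bigcap_k [set t | a k <= X t]) by exact: bigcapT_measurable.
suff PI : P (\bigcap_k [set t | a k <= X t]) = 0%E.
  exists (\bigcap_k [set t | a k <= X t]); split => // t /= Xt k _ /=.
  by rewrite leNgt; apply/negP => h; apply: Xt; exists k.
apply/eqP; rewrite eq_le measure_ge0 andbT.
have Pk k : (P (\bigcap_k [set t | (a k <= X t)%R]) <= (q / 2 ^+ k)%:E)%E.
  by apply: le_trans (X_tail k); apply: le_measure; rewrite ?inE// => t; exact.
have Pfin : P (\bigcap_k [set t | a k <= X t]) \is a fin_num by exact: fin_num_measure.
rewrite -(fineK Pfin) lee_fin leNgt; apply/negP => x0.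
set x := fine _ in x0 *.
(* This index [k] satisfies [2 ^ k > k > q / x], which contradicts [x <= q / 2 ^+ k]. *)
have := Pk (Num.truncn (q / x)).+1; rewrite -(fineK Pfin) -/x lee_fin.
apply/negP; rewrite -ltNge ltr_pdivrMr ?exprn_gt0// -ltr_pdivrMl//.
rewrite mulrC; apply: lt_trans (truncnS_gt _) _.
by rewrite -natrX ltr_nat ltn_expl.
Qed.

(** The excess is dominated by the sum of the increments [a k.+1 - a k] over the levels that [X]
    reaches; the expectations form a series dominated by a geometric one of ratio [3 / 4], whence
    the factor [4]. *)
Lemma expectation_excess_le :
  (\int[P]_t (Num.max (X t - a 0) 0)%:E <= (4 * (e * a 0 * q))%:E)%E.
Proof.
pose f k t := ((a k.+1 - a k) * \1_[set t | a k <= X t] t)%:E.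
have f0 k t : (0 <= f k t)%E by rewrite lee_fin mulr_ge0// subr_ge0.
have mf k : measurable_fun [set: T] (f k).
  apply/measurable_EFinP; apply: measurable_funM => //.
apply: (@le_trans _ _ (\int[P]_t \sum_(0 <= k <oo) f k t)%E).
  apply: ae_ge0_le_integral => //.
  - by move=> t _; rewrite lee_fin le_max lexx orbT.
  - apply/measurable_EFinP; apply: measurable_maxr => //.
    exact: measurable_funB.
  - by move=> t _; exact: nneseries_ge0.
  - exact: ge0_emeasurable_sum.
  apply: filterS below_some_level_ae => t Xt _.
  (* [K] is the first level above [X t]: all indicators before it equal [1], and the sum telescopes
     to [a K - a 0]. *)
  case: (ex_minnP Xt) => K XK Kmin.
  apply: le_trans (nneseries_lim_ge K _) => //.
  rewrite (eq_big_nat _ _ (F2 := fun k => (a k.+1 - a k)%:E)); last first.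
    move=> k /= kK; rewrite /f indicE mem_set ?mulr1//=.
    by rewrite leNgt; apply/negP => /Kmin; rewrite leqNgt kK.
  rewrite sumEFin lee_fin telescope_sumr// ge_max lerD2r ltW//=.
  rewrite subr_ge0; elim: (K) => // k IH; exact: le_trans IH (a_incr k).
rewrite integral_nneseries//.
apply: lime_le; first by apply: is_cvg_nneseries => k _ _; exact: integral_ge0.
apply: nearW => N.
apply: (@le_trans _ _ (\sum_(0 <= k < N) (e * a 0 * q * (3 / 4) ^+ k)%:E)%E).
  apply: lee_sum => k _; rewrite /f; under eq_integral do rewrite EFinM.
  rewrite ge0_integralZl_EFin//; last 2 first.
    by apply/measurable_EFinP; apply: measurable_indic; exact: mtail.
    by rewrite subr_ge0.
  rewrite integral_indic// setIT.
  apply: (@le_trans _ _ ((a k.+1 - a k)%:E * (q / 2 ^+ k)%:E)%E).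
    by apply: lee_wpmul2l; [rewrite lee_fin subr_ge0|exact: X_tail].
  by rewrite -EFinM lee_fin levels_increment.
rewrite sumEFin lee_fin.
have := @geometric_le_lim R N (e * a 0 * q) (3 / 4).
rewrite /series/= /geometric/= => /(_ _ _ _) H.
apply: le_trans (H _ _ _) _; first by rewrite !mulr_ge0.
- by rewrite divr_gt0.
- by rewrite ger0_norm ?divr_ge0// ltr_pdivrMr// mul1r ltr_nat.
- rewrite (_ : 1 - 3 / 4 = 4^-1) ?invrK 1?mulrC//.
  by apply/eqP; rewrite subr_eq; apply/eqP; field.
Qed.

End excess.

Lemma expectation_max_assignment_le (R : realType) d (T : measurableType d)
    (P : probability T R) (n : nat) (gam h : 'I_n * 'I_n -> T -> R)
    (a : nat -> R) (e q : R) :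
  (forall ij, measurable_fun [set: T] (weight gam h ij)) ->
  (forall ij, {ae P, forall t, 0 <= weight gam h ij t}) ->
  0 <= e <= 2^-1 -> 0 <= q -> 0 <= a 0 ->
  (forall k, a k <= a k.+1 <= (1 + e) * a k) ->
  (forall ij k, (P [set t | (a k <= weight gam h ij t)%R] <= (q / 2 ^+ k)%:E)%E) ->
  ('E_P[max_assignment gam h] <=
   (n%:R * a 0 + n%:R ^+ 2 * (4 * (e * a 0 * q)))%:E)%E.
Proof.
move=> mW W0 /andP[e0 e1] q0 a00 age tail.
rewrite expectation_max_assignment//.
pose X ij t := (Num.max (weight gam h ij t - a 0) 0)%:E.
have mX ij : measurable_fun [set: T] (X ij).
  by apply/measurable_EFinP; apply: measurable_maxr => //; exact: measurable_funB.
have X0 ij t : (0 <= X ij t)%E by rewrite lee_fin le_max lexx orbT.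
apply: (@le_trans _ _ (\int[P]_t ((n%:R * a 0)%:E + \sum_ij X ij t))%E).
  apply: ge0_le_integral => //.
  - by move=> t _; rewrite lee_fin le_max lexx orbT.
  - apply/measurable_EFinP; apply: measurable_maxr => //.
    exact: measurable_max_assignment.
  - by apply: emeasurable_funD => //; exact: emeasurable_sum.
  move=> t _; rewrite /X sumEFin -EFinD lee_fin ge_max.
  have S0 : 0 <= \sum_ij Num.max (weight gam h ij t - a 0) 0.
    by apply: sumr_ge0 => ij _; rewrite le_max lexx orbT.
  rewrite addr_ge0 ?mulr_ge0// andbT.
  apply: max_assignment_le => s; rewrite /assignment_value.
  (* The excess of the chosen entry is bounded by that of its whole row, which removes the
     dependence on [s]. *)
  apply: (@le_trans _ _ (\sum_(i < n) (a 0 +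
      \sum_(j < n) Num.max (weight gam h (i, j) t - a 0) 0))).
    apply: ler_sum => i _; rewrite -lerBlDl (bigD1 (s i))//=.
    rewrite -[leLHS]addr0 lerD ?le_max ?lexx//.
    by apply: sumr_ge0 => j _; rewrite le_max lexx orbT.
  rewrite big_split/= sumr_const card_ord mulr_natl lerD2l pair_bigA/=.
  by under eq_bigr do rewrite -surjective_pairing.
rewrite ge0_integralD//; last 3 first.
- by move=> t _; rewrite lee_fin mulr_ge0.
- by move=> t _; exact: sume_ge0.
- exact: emeasurable_sum.
rewrite integral_cst// [X in (_ * X + _)%E]probability_setT mule1 EFinD leeD2l//.
rewrite ge0_integral_sum//.
apply: (@le_trans _ _ (\sum_(ij : 'I_n * 'I_n) (4 * (e * a 0 * q))%:E)%E).
  apply: lee_sum => ij _; apply: expectation_excess_le => // k.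
  - by have /andP[] := age k.
  - by have /andP[] := age k.
rewrite sumEFin lee_fin sumr_const card_prod card_ord.
by rewrite -[leLHS]mulr_natl natrM expr2.
Qed.

(** * Asymptotics from slow variation *)

Lemma near_at_right0 (R : realType) (Q : R -> Prop) :
  (\forall p \near 0^'+, Q p) ->
  exists2 dlt : R, 0 < dlt & forall p, 0 < p < dlt -> Q p.
Proof.
case/nbhs_ballP => dlt /= dlt0 H; exists dlt => // p /andP[p0 pd].
by apply: H => //; rewrite /ball/= sub0r normrN gtr0_norm.
Qed.

(** Since [expR 1 >= 2], one has [4 / expR 3 <= 1 / 2], and [2 ^ n > n]. This bounds the failure
    probability in the lower estimate. *)
Lemma expn4_expR_le (R : realType) n : (0 < n)%N ->
  4 ^+ n * expR (- (3 * n%:R)) <= n%:R^-1 :> R.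
Proof.
move=> n0; have e1 : 2 <= expR 1 :> R by have := expR_ge1Dx (1 : R).
have e3 : 8 <= expR 3 :> R.
  rewrite (_ : 8 = 2 ^+ 3); last by rewrite -natrX.
  by rewrite -[X in expR X]mulr1 expRM_natl lerXn2r ?nnegrE ?expR_ge0.
rewrite expRN [3 * _]mulrC expRM_natl -expr_div_n.
apply: (@le_trans _ _ (2^-1 ^+ n)).
  rewrite lerXn2r ?nnegrE ?divr_ge0 ?expR_ge0// ler_pdivrMr ?expR_gt0//.
  by rewrite mulrC ler_pdivlMr// -natrM.
by rewrite exprVn lef_pV2 ?posrE ?exprn_gt0 ?ltr0n// -natrX ler_nat ltnW// ltn_expl.
Qed.

Theorem theorem1 (R : realType)
  (d0 : measure_display) (T0 : measurableType d0) (P0 : probability T0 R)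
  (gamma0 : {RV P0 >-> R})
  (gamma0_ge0 : {ae P0, forall t, 0 <= gamma0 t})
  (g : R -> R) (p0 : R) (p0_range : 0 < p0 <= 1)
  (g_solution : forall p : R, 0 < p < p0 -> Lambda_solution P0 gamma0 p (g p))
  (d : nat -> measure_display)
  (T : forall n : nat, measurableType (d n))
  (P : forall n : nat, probability (T n) R)
  (gam h : forall n : nat, 'I_n * 'I_n -> {RV (P n) >-> R})
  (gam_iid : forall n : nat, iid_copies (gam n) (distribution P0 gamma0))
  (h_iid : forall n : nat, iid_copies (h n) (exponential_prob (1 : R)))
  (gam_h_indep : forall n : nat, independent_families (P n)
     (fun ij => gam n ij : T n -> R) (fun ij => h n ij : T n -> R))
  (g_sv : slowly_varying_at_zero g) :
  ('E_(P n)[max_assignment (fun ij => gam n ij : T n -> R)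
                           (fun ij => h n ij : T n -> R)]
     / (n%:R * g (n%:R^-1))%:E)%E @[n --> \oo] --> (1%:E : \bar R).
Proof.
have /andP[p0_gt0 p0_le1] := p0_range.
pose w n ij := weight (fun ij => gam n ij : T n -> R) (fun ij => h n ij : T n -> R) ij.
have mw n ij : measurable_fun [set: T n] (w n ij) by exact: measurable_weight.
have w0 n ij : {ae P n, forall t, 0 <= w n ij t}.
  exact: (weight_ge0 _ _ _ _ _ gamma0_ge0 _ _ _ _ _ _ (gam_iid n) (h_iid n)).
have solE p : 0 < p < p0 -> p%:E = Lambda P0 gamma0 (expR (g p) - 1).
  by case/g_solution.
have tail n ij p : 0 < p < p0 -> 0 < g p -> P n [set t | g p <= w n ij t] = p%:E.
  move=> pp gp; apply: (weight_tail _ _ _ _ _ gamma0_ge0 _ _ _ _ _ _ (gam_iid n) (h_iid n)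
    (gam_h_indep n)) => //.
  exact: solE.
have below n (J : {set 'I_n * 'I_n}) p : 0 < p < p0 -> 0 < g p ->
    P n (\bigcap_(ij in [set` J]) [set t | w n ij t < g p]) = ((1 - p) ^+ #|J|)%:E.
  move=> pp gp; apply: (weights_lt _ _ _ _ _ gamma0_ge0 _ _ _ _ _ _ (gam_iid n) (h_iid n)
    (gam_h_indep n)) => //.
  exact: solE.
have [gpos gsv] := g_sv.
have [d1 d1_gt0 gd1] := near_at_right0 _ _ gpos.
(* If [g p < g p'], the event [g p' <= w] lies in [g p <= w], and their probabilities give
   [p' <= p]. The single weight of the [1 x 1] array serves as witness. *)
have g_anti p p' : 0 < p -> p < p' -> p' < d1 -> p' < p0 -> g p' <= g p.
  move=> p_gt0 pp' p'd1 p'p0; rewrite leNgt; apply/negP => gpp'.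
  have : (p'%:E <= p%:E)%E.
    rewrite -(tail 1%N (ord0, ord0) p) ?gd1 ?p_gt0 ?(lt_trans pp')//.
    rewrite -(tail 1%N (ord0, ord0) p') ?gd1 ?(lt_trans p_gt0)//.
    apply: le_measure; rewrite ?inE.
    - by rewrite -[X in measurable X]setTI; exact: measurable_fun_le.
    - by rewrite -[X in measurable X]setTI; exact: measurable_fun_le.
    by move=> t /=; apply: le_trans; exact: ltW.
  by rewrite lee_fin leNgt pp'.
have small (x : R) : 0 < x -> \forall n \near \oo, (0 < n)%N /\ (n%:R^-1 : R) < x.
  move=> x_gt0; near=> n; split; first by near: n; exact: nbhs_infty_gt.
  rewrite -[ltRHS]invrK ltf_pV2 ?posrE ?invr_gt0//; last first.
    by rewrite ltr0n; near: n; exact: nbhs_infty_gt.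
  by near: n; exact: nbhs_infty_gtr.
(* Slow variation in multiplied-out form; [dlt <= d1] keeps [g p] positive. *)
have ratio (c e : R) : 0 < c -> 0 < e -> exists2 dlt, 0 < dlt &
    forall p, 0 < p < dlt -> (1 - e) * g p <= g (c * p) <= (1 + e) * g p.
  move=> c_gt0 e_gt0.
  have /cvgrPdist_le/(_ e e_gt0)/near_at_right0[d2 d2_gt0 gd2] := gsv c c_gt0.
  exists (Num.min d1 d2); first by rewrite lt_min d1_gt0.
  move=> p /andP[p_gt0]; rewrite lt_min => /andP[pd1 pd2].
  have gp : 0 < g p by rewrite gd1// p_gt0.
  have := gd2 p; rewrite p_gt0 pd2 => /(_ isT).
  rewrite distrC ler_norml lerBlDl lerBrDl => /andP[].
  by rewrite ler_pdivlMr// ler_pdivrMr// => -> ->.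
have pos : \forall n \near \oo, 0 < n%:R * g n%:R^-1.
  near=> n; have [n_gt0 nd1] : (0 < n)%N /\ (n%:R^-1 : R) < d1.
    by near: n; exact: small.
  by rewrite mulr_gt0 ?ltr0n// gd1// invr_gt0 ltr0n n_gt0.
pose M n := max_assignment (fun ij => gam n ij : T n -> R) (fun ij => h n ij : T n -> R).
have upper (e : R) : 0 < e <= 2^-1 -> \forall n \near \oo,
    ('E_(P n)[M n] <= (n%:R * g n%:R^-1 * (1 + 4 * e))%:E)%E.
  move=> /andP[e_gt0 e_le].
  have h2 : 0 < 2^-1 :> R by rewrite invr_gt0.
  have [d2 d2_gt0 gd2] := ratio 2^-1 e h2 e_gt0.
  near=> n; have [n_gt0] : (0 < n)%N /\ (n%:R^-1 : R) < Num.min d1 (Num.min d2 p0).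
    by near: n; apply: small; rewrite !lt_min d1_gt0 d2_gt0.
  rewrite !lt_min => /and3P[nd1 nd2 np0].
  have q_gt0 : 0 < n%:R^-1 :> R by rewrite invr_gt0 ltr0n.
  (* The levels are [g (p k)]; one halving of [p] raises the level by a factor of at most [1 + e],
     by [ratio] with [c = 1 / 2]. *)
  pose p k : R := n%:R^-1 / 2 ^+ k.
  have p_gt0 k : 0 < p k by rewrite divr_gt0 ?exprn_gt0.
  have p_le k : p k <= n%:R^-1.
    rewrite ler_pdivrMr ?exprn_gt0//; apply: ler_peMr; first exact: ltW.
    by rewrite exprn_ege1// ler1n.
  have pS k : p k.+1 = 2^-1 * p k by rewrite /p exprS invfM mulrCA.
  have pE0 : p 0%N = n%:R^-1 by rewrite /p expr0 divr1.
  have gp k : 0 < g (p k) by rewrite gd1// p_gt0 (le_lt_trans (p_le k)).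
  have pr k : 0 < p k < p0 by rewrite p_gt0 (le_lt_trans (p_le k)).
  apply: le_trans (expectation_max_assignment_le _ _ _ _ _ _ _ (fun k => g (p k)) e
    n%:R^-1 (mw n) (w0 n) _ _ _ _ _) _.
  - by rewrite ltW.
  - exact: ltW.
  - exact: ltW.
  - move=> k; apply/andP; split.
      apply: g_anti => //; [|exact: le_lt_trans nd1|exact: le_lt_trans np0].
      by rewrite pS gtr_pMl// invf_lt1// ltr1n.
    have pd2 : 0 < p k < d2 by rewrite p_gt0 (le_lt_trans (p_le k)).
    by rewrite pS; case/andP: (gd2 _ pd2).
  - by move=> ij k; rewrite -/(w n ij) tail.
  (* With [q = 1 / n] the [n ^ 2] excess terms add up to [4 * e * n * g (1 / n)], so the two bounds
     are equal. *)
  rewrite lee_fin pE0 le_eqVlt; apply/orP; left; apply/eqP.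
  by field; rewrite pnatr_eq0 -lt0n.
have lower (e : R) : 0 < e <= 2^-1 -> \forall n \near \oo,
    ((n%:R * g n%:R^-1 * (1 - 3 * e))%:E <= 'E_(P n)[M n])%E.
  move=> /andP[e_gt0 e_le].
  (* Chosen so that [p = c / n] turns the exponent [p * (e * n) ^+ 2] into [3 * n]. *)
  pose c := 3 / e ^+ 2.
  have c_gt0 : 0 < c by rewrite divr_gt0 ?exprn_gt0.
  have [d2 d2_gt0 gd2] := ratio c e c_gt0 e_gt0.
  (* [1 / n < e] makes the failure probability smaller than [e]; the bounds divided by [c] place
     [c / n] below [d1] and [p0]. *)
  near=> n; have [n_gt0] : (0 < n)%N /\ (n%:R^-1 : R) <
      Num.min (Num.min d1 d2) (Num.min e (Num.min (d1 / c) (p0 / c))).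
    by near: n; apply: small; rewrite !lt_min d1_gt0 d2_gt0 e_gt0 (divr_gt0 d1_gt0 c_gt0) (divr_gt0 p0_gt0 c_gt0).
  rewrite !lt_min => /and3P[/andP[nd1 nd2] ne /andP[nd1c np0c]].
  have q_gt0 : 0 < n%:R^-1 :> R by rewrite invr_gt0 ltr0n.
  pose p := c * n%:R^-1.
  have ncd1 : p < d1 by rewrite /p mulrC -ltr_pdivlMr.
  have ncp0 : p < p0 by rewrite /p mulrC -ltr_pdivlMr.
  have p_gt0 : 0 < p by rewrite mulr_gt0.
  have gp : 0 < g p by rewrite gd1// p_gt0.
  have gn : 0 < g n%:R^-1 by rewrite gd1// q_gt0.
  have pr : 0 < p < p0 by rewrite p_gt0.
  have p01 : 0 <= p <= 1 by rewrite !ltW// (lt_le_trans ncp0).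
  have e01 : 0 <= e <= 1 by rewrite ltW//= (le_trans e_le)// invf_le1// ler1n.
  apply: le_trans (expectation_max_assignment_ge _ _ _ _ _ _ _ (mw n) (w0 n)
    (g p) p e (ltW gp) p01 e01 (fun J => below n J p pr gp)).
  have -> : p * (e * n%:R) ^+ 2 = 3 * n%:R.
    by rewrite /p /c; field; rewrite pnatr_eq0 -lt0n n_gt0 gt_eqF.
  have h4 := le_trans (expn4_expR_le R n n_gt0) (ltW ne).
  have /andP[gpn _] := gd2 n%:R^-1 (introT andP (conj q_gt0 nd2)).
  rewrite lee_fin -/p in gpn *.
  have n_gt0R : 0 < n%:R :> R by rewrite ltr0n.
  set Q := 4 ^+ n * _ in h4 *.
  have e1 : 0 <= 1 - e by rewrite subr_ge0; case/andP: e01.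
  have NG : 0 <= n%:R * g n%:R^-1 by rewrite mulr_ge0 ?ltW.
  (* The three factors [1 - e] come from [g (c / n)] against [g (1 / n)], from the proportion of
     large entries, and from the failure probability; their product is at least [1 - 3 * e]. *)
  apply: (@le_trans _ _ ((1 - e) * g n%:R^-1 * (1 - e) * n%:R * (1 - e))).
    rewrite -subr_ge0.
    have -> : (1 - e) * g n%:R^-1 * (1 - e) * n%:R * (1 - e) -
        n%:R * g n%:R^-1 * (1 - 3 * e) =
        n%:R * g n%:R^-1 * (e ^+ 2 * (2 + (1 - e))) by ring.
    rewrite mulr_ge0// mulr_ge0//; last exact: addr_ge0.
    by rewrite exprn_ge0// ltW.
  have Q1 : 1 - e <= 1 - Q by rewrite lerD2l lerN2.
  rewrite ler_pM// ?mulr_ge0// ?(ltW gn)//.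
  by rewrite ler_wpM2r// ler_wpM2r.
have bounds (e : R) : 0 < e <= 2^-1 -> \forall n \near \oo,
    ((1 - 4 * e)%:E <= 'E_(P n)[M n] / (n%:R * g n%:R^-1)%:E <= (1 + 4 * e)%:E)%E.
  move=> he; have /andP[e_gt0 _] := he; near=> n.
  have x_gt0 : 0 < n%:R * g n%:R^-1 by near: n.
  rewrite inver gt_eqF// lee_pdivlMr// lee_pdivrMr// -!EFinM.
  rewrite [(1 + 4 * _) * _]mulrC [(1 - 4 * _) * _]mulrC.
  apply/andP; split; last by near: n; exact: upper.
  (* The constant [3] is relaxed to [4] to make the window around [1] symmetric. *)
  apply: (@le_trans _ _ (n%:R * g n%:R^-1 * (1 - 3 * e))%:E); last first.
    by near: n; exact: lower.
  by rewrite lee_fin ler_wpM2l ?(ltW x_gt0)// lerD2l lerN2 ler_wpM2r ?ltW// ltr_nat.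
(* Convergence in the extended reals splits into eventual finiteness and convergence of the real
   parts; [bounds] supplies both. *)
apply/fine_cvgP.
have fin (e : R) : 0 < e <= 2^-1 -> \forall n \near \oo,
    ('E_(P n)[M n] / (n%:R * g n%:R^-1)%:E)%E \is a fin_num.
  move=> he; near=> n.
  have /andP[l u] : ((1 - 4 * e)%:E <=
      'E_(P n)[M n] / (n%:R * g n%:R^-1)%:E <= (1 + 4 * e)%:E)%E.
    by near: n; exact: bounds.
  by rewrite fin_numElt (lt_le_trans _ l) ?ltNyr// (le_lt_trans u) ?ltry.
split; first by apply: (fin 2^-1); rewrite lexx andbT invr_gt0.
apply/cvgrPdist_le => eps eps_gt0.
pose e := Num.min (eps / 4) 2^-1.
have he : 0 < e <= 2^-1.
  by rewrite /e lt_min (divr_gt0 eps_gt0)// invr_gt0 ltr0n/= ge_min lexx orbT.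
have eE : 4 * e <= eps.
  by rewrite mulrC -ler_pdivlMr// /e ge_min lexx.
near=> n.
have /fineK E : ('E_(P n)[M n] / (n%:R * g n%:R^-1)%:E)%E \is a fin_num.
  by near: n; exact: (fin e he).
have : ((1 - 4 * e)%:E <= 'E_(P n)[M n] / (n%:R * g n%:R^-1)%:E <= (1 + 4 * e)%:E)%E.
  by near: n; exact: bounds.
rewrite -E !lee_fin /= => /andP[l u].
rewrite distrC ler_norml lerBlDl lerBrDl (le_trans _ l) ?(le_trans u)//.
  by rewrite lerD2l.
by rewrite lerD2l lerN2.
Unshelve. all: by end_near.
Qed.
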